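(* Let $(M,g)$ be a semi-Riemannian manifold, let $u:M\to\mathbb{R}$ be a $C^2$ function, and let $F:M\to \bar M:=M\times\mathbb{R}$, $F(x)=(x,u(x))$, be its graph map. Let $\varepsilon\in\{1,-1\}$ and assume that $F:(M,\gamma=F^*\langle\cdot,\cdot\rangle)\to(\bar M,\langle\cdot,\cdot\rangle=g+\varepsilon\,dt^2)$ is a semi-Riemannian hypersurface with unit upward normal $\nu$ such that $\langle\nu,\nu\rangle=\varepsilon'\in\{1,-1\}$. Then $F$ is a (vertical) translating soliton if and only if $u$ satisfies $$\mathrm{div}\left(\frac{\nabla u}{\sqrt{\varepsilon'(\varepsilon+|\nabla u|_g^2)}}\right)=\frac{1}{\sqrt{\varepsilon'(\varepsilon+|\nabla u|_g^2)}}$$ on $M$.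
   Context: $\nabla u$ and $\mathrm{div}$ are the gradient and divergence with respect to $g$, and $|\nabla u|_g^2=g(\nabla u,\nabla u)$ (possibly negative). $\partial_t$ is the unit Killing vector field on $M\times\mathbb{R}$ tangent to the $\mathbb{R}$ factor, so $\langle\partial_t,\partial_t\rangle=\varepsilon$. $F$ is a semi-Riemannian hypersurface when $F^*\langle\cdot,\cdot\rangle$ is nondegenerate. The unit upward normal is $\nu=\frac1W(-\varepsilon\nabla u+\partial_t)$ with $W=\sqrt{\varepsilon'(\varepsilon+|\nabla u|_g^2)}>0$, where $\varepsilon'=\mathrm{sign}(\varepsilon+|\nabla u|_g^2)$ is constant on $M$. The mean curvature vector $\vec H$ is the trace (not normalized by dimension) of the second fundamental form of $F$ with respect to the induced metric. $F$ is called a (vertical) translating soliton if $\vec H=\partial_t^{\perp}$, where $\partial_t^\perp$ is the component of $\partial_t$ normal to $F$. *)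

(* Defs.v *)
From HB Require Import structures.
From mathcomp Require Import all_boot all_order all_algebra.
From mathcomp Require Import all_classical all_reals all_analysis.

Set Implicit Arguments.
Unset Strict Implicit.
Unset Printing Implicit Defensive.

Import Order.TTheory GRing.Theory Num.Theory.
Import numFieldNormedType.Exports.

Local Open Scope classical_set_scope.
Local Open Scope ring_scope.

(* Coordinates are row vectors. A tensor field on a manifold is given by its
   components in every chart of the atlas, as functions of the coordinates of
   that chart; these functions are meaningful only on the image of the chart.
   Statements about tensors are quantified over all charts at each point. *)

Section Calculus.
Context {R : realType} {n : nat} {W : normedModType R}.

Definition partial (i : 'I_n) (f : 'rV[R]_n -> W) (x : 'rV[R]_n) : W :=
  'D_(delta_mx 0 i) f x.

(* f is of class C^k on the open set V. *)
Fixpoint Ck (k : nat) (V : set 'rV[R]_n) (f : 'rV[R]_n -> W) : Prop :=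
  match k with
  | 0%N => forall x, V x -> {for x, continuous f}
  | k'.+1 => (forall x, V x -> differentiable f x) /\
             (forall i, Ck k' V (partial i f))
  end.

End Calculus.

Section Index.
Context {R : realType} {n : nat}.

Definition negdef_on (A W : 'M[R]_n) : Prop :=
  forall v : 'rV[R]_n, (v <= W)%MS -> v != 0 -> (v *m A *m v^T) 0 0 < 0.

(* q is the largest dimension of a subspace on which the symmetric bilinear
   form A is negative definite. *)
Definition has_index (A : 'M[R]_n) (q : nat) : Prop :=
  (exists W : 'M[R]_n, \rank W = q /\ negdef_on A W) /\
  (forall W : 'M[R]_n, negdef_on A W -> (\rank W <= q)%N).

End Index.

(* An atlas together with the components of a (0,2)-tensor in each chart; the
   axioms of a semi-Riemannian manifold are in [semi_riemannian] below. Only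
   the values of [chart c] on [dom c] and of [param c], its inverse, and
   [metric c] on [chart c @` dom c] matter. *)
Record metricAtlas (R : realType) (n : nat) := MetricAtlas {
  point :> topologicalType;
  cidx : Type;
  dom : cidx -> set point;
  chart : cidx -> point -> 'rV[R]_n;
  param : cidx -> 'rV[R]_n -> point;
  metric : cidx -> 'rV[R]_n -> 'M[R]_n
}.

Section Geometry.
Context {R : realType} {n : nat}.
Variable M : metricAtlas R n.

Definition codom (c : cidx M) : set 'rV[R]_n := chart c @` dom c.

Definition overlap (c d : cidx M) : set 'rV[R]_n :=
  chart c @` (dom c `&` dom d).

Definition transition (c d : cidx M) : 'rV[R]_n -> 'rV[R]_n :=
  chart d \o param c.

Record semi_riemannian : Prop := {
  sr_hausdorff : hausdorff_space M;
  sr_second_countable : @second_countable M;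
  sr_dom_open : forall c : cidx M, open (dom c);
  sr_cover : forall p : M, exists c, dom c p;
  sr_codom_open : forall c : cidx M, open (codom c);
  sr_paramK : forall (c : cidx M) p, dom c p -> param c (chart c p) = p;
  sr_chart_continuous : forall (c : cidx M) p,
    dom c p -> {for p, continuous (chart c)};
  sr_param_continuous : forall (c : cidx M) x,
    codom c x -> {for x, continuous (param c)};
  sr_transition_smooth : forall (c d : cidx M) k,
    Ck k (overlap c d) (transition c d);
  sr_metric_smooth : forall (c : cidx M) k, Ck k (codom c) (metric c);
  sr_metric_sym : forall (c : cidx M) x,
    codom c x -> (metric c x)^T = metric c x;
  sr_metric_unit : forall (c : cidx M) x,
    codom c x -> metric c x \in unitmx;
  sr_metric_index : exists q, forall (c : cidx M) x,
    codom c x -> has_index (metric c x) q;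
  (* ['J f x] has the i-th partial derivative of f at x as its i-th row. *)
  sr_metric_tensor : forall (c d : cidx M) x, overlap c d x ->
    metric c x = 'J (transition c d) x *m metric d (transition c d x)
                   *m ('J (transition c d) x)^T
}.

Definition ip (c : cidx M) (x v w : 'rV[R]_n) : R :=
  (v *m metric c x *m w^T) 0 0.

(* Components (Gamma_ij^k)_k of the Levi-Civita derivative of the j-th
   coordinate field in the direction of the i-th one. *)
Definition christoffel (c : cidx M) (i j : 'I_n) (x : 'rV[R]_n) : 'rV[R]_n :=
  \row_k (2^-1 * \sum_l invmx (metric c x) k l *
    (partial i (metric c) x j l + partial j (metric c) x i l
     - partial l (metric c) x i j)).

Definition ck_function (k : nat) (u : M -> R) : Prop :=
  forall c : cidx M, Ck k (codom c) (u \o param c).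

Definition grad (u : M -> R) (c : cidx M) (x : 'rV[R]_n) : 'rV[R]_n :=
  (\row_i partial i (u \o param c) x) *m invmx (metric c x).

Definition grad_sqnorm (u : M -> R) (c : cidx M) (x : 'rV[R]_n) : R :=
  ip c x (grad u c x) (grad u c x).

(* Trace of the Levi-Civita covariant derivative of the vector field X. *)
Definition divergence (X : cidx M -> 'rV[R]_n -> 'rV[R]_n)
    (c : cidx M) (x : 'rV[R]_n) : R :=
  \sum_i (partial i (X c) x + \sum_j X c x 0 j *: christoffel c i j x) 0 i.

End Geometry.

(* Extrinsic geometry of a map F : M -> N of class C^2, N carrying a metric,
   in a chart c of M and a chart d of N; x is the coordinate in c. *)
Section Extrinsic.
Context {R : realType} {n m : nat}.
Variables (M : metricAtlas R n) (N : metricAtlas R m) (F : M -> N).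
Variables (c : cidx M) (d : cidx N).

Definition local_rep : 'rV[R]_n -> 'rV[R]_m := chart d \o F \o param c.

Definition ambient_metric (x : 'rV[R]_n) : 'M[R]_m := metric d (local_rep x).

Definition induced_metric (x : 'rV[R]_n) : 'M[R]_n :=
  'J local_rep x *m ambient_metric x *m ('J local_rep x)^T.

(* Levi-Civita derivative along F, in the i-th coordinate direction, of the
   image under dF of the j-th coordinate field. *)
Definition cov_dF (i j : 'I_n) (x : 'rV[R]_n) : 'rV[R]_m :=
  partial i (partial j local_rep) x +
  \sum_a \sum_b (partial i local_rep x 0 a * partial j local_rep x 0 b) *:
    christoffel d a b (local_rep x).

(* [kermx (G *m J^T)] is the orthogonal complement of the row space of J, which
   is the tangent space of F. The two are complementary exactly when the
   induced metric is nondegenerate and F is an immersion. *)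
Definition normal_part (x : 'rV[R]_n) (v : 'rV[R]_m) : 'rV[R]_m :=
  v *m proj_mx (kermx (ambient_metric x *m ('J local_rep x)^T))
               <<'J local_rep x>>%MS.

Definition second_form (i j : 'I_n) (x : 'rV[R]_n) : 'rV[R]_m :=
  normal_part x (cov_dF i j x).

Definition mean_curvature (x : 'rV[R]_n) : 'rV[R]_m :=
  \sum_i \sum_j invmx (induced_metric x) i j *: second_form i j x.

End Extrinsic.

Definition nondegenerate_map (R : realType) (n m : nat)
    (M : metricAtlas R n) (N : metricAtlas R m) (F : M -> N) : Prop :=
  forall (c : cidx M) (d : cidx N) (p : M), dom c p -> dom d (F p) ->
    induced_metric F c d (chart c p) \in unitmx.

Section ProductWithLine.
Context {R : realType} {n : nat}.
Variables (M : metricAtlas R n) (eps : R).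

(* M x R with the metric g + eps dt^2; its charts are (p, t) |-> (c(p), t). *)
Definition prod_line : metricAtlas R (n + 1) := {|
  point := (M * R)%type : topologicalType;
  cidx := cidx M;
  dom := fun c => dom c `*` setT;
  chart := fun c q => row_mx (chart c q.1) (q.2)%:M;
  param := fun c y => (param c (lsubmx y), rsubmx y 0 0);
  metric := fun c y => block_mx (metric c (lsubmx y)) 0 0 eps%:M
|}.

(* Components, in any of these charts, of the field d/dt. *)
Definition d_t : 'rV[R]_(n + 1) := row_mx 0 1%:M.

Definition graph_map (u : M -> R) : M -> prod_line := fun p => (p, u p).

Definition graph_W (u : M -> R) (c : cidx M) (x : 'rV[R]_n) : R :=
  Num.sqrt (Num.sg (eps + grad_sqnorm u c x) * (eps + grad_sqnorm u c x)).

Definition upward_normal (u : M -> R) (c : cidx M) (x : 'rV[R]_n) :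
    'rV[R]_(n + 1) :=
  (graph_W u c x)^-1 *: (row_mx (- eps *: grad u c x) 0 + d_t).

Definition translating_soliton (F : M -> prod_line) : Prop :=
  forall (c : cidx M) (d : cidx prod_line) (p : M), dom c p -> dom d (F p) ->
    mean_curvature F c d (chart c p) = normal_part F c d (chart c p) d_t.

End ProductWithLine.

(* Main.v *)
Require Import Defs.
From HB Require Import structures.
From mathcomp Require Import all_boot all_order all_algebra.
From mathcomp Require Import all_classical all_reals all_analysis.
From mathcomp Require Import ring.
Import Order.TTheory GRing.Theory Num.Theory.
Import numFieldNormedType.Exports.
Local Open Scope classical_set_scope.
Local Open Scope ring_scope.
Set Implicit Arguments.
Unset Strict Implicit.
Unset Printing Implicit Defensive.

(** At a point where charts c and d of M overlap, let phi be the transition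
    map from c to d, P its Jacobian, y the image point, f the height function
    read in d, D the row of its partial derivatives at y, and g the metric in
    d at y.  In these charts the graph map is z |-> (phi z, f (phi z)), and
    everything extrinsic is governed by the column C = (-D, 1), which
    annihilates exactly the tangent vectors of the graph.  Lowering the index
    of N = (-eps grad u, 1) gives eps C, so N is normal and <N, N> is
    q = eps + |grad u|^2.  The normal part of v is therefore
    (eps / q) (v C) N ([normal_partE]), and since d/dt pairs to 1 with C, the
    equation H = (d/dt)^perp is the single scalar equation

      tr_gamma (second derivative of F, paired with C) = 1.

    The product metric has no Christoffel symbols involving the line
    ([christoffel_prod]), so the pairing of the covariant second derivative
    with C is the Hessian of u, pulled back by P ([cov_dF_conormal]).  The
    induced metric is P (g + eps D^T D) P^T, a rank-one perturbation inverted
    by the Sherman-Morrison formula; P drops out of the trace, and the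
    soliton equation becomes S = 1 with

      S = tr_g Hess u - Hess u (grad u, grad u) / q

    ([soliton_chartP]).

    On the other side, metric compatibility gives
    d |grad u|^2 = 2 Hess u (grad u, .), so that, with s = 1 / sqrt (eps' q),

      div (s grad u) = s (tr_g Hess u - Hess u (grad u, grad u) / q) = s S

    ([divergence_unit_grad]).  The condition on the normal says exactly that
    eps' q > 0, hence s <> 0 and the PDE is the same equation S = 1.  Letting
    c and d differ from the outset makes the independence of the charts part
    of the computation: S only depends on the chart d of the target. *)

(** * Differential calculus of matrix-valued maps *)

Section MatrixCalculus.
Context {R : realType} {V : normedModType R}.

Lemma differentiable_mxP m k (A : V -> 'M[R]_(m, k)) x :
  (forall i j, differentiable (fun y => A y i j) x) <-> differentiable A x.
Proof.
split=> [dA|dA i j]; last first.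
  exact: (differentiable_comp dA (differentiable_coord _ i j)).
rewrite (_ : A = fun y => \sum_i \sum_j A y i j *: delta_mx i j); last first.
  by apply/funext => y; rewrite [LHS]matrix_sum_delta.
rewrite -fct_sumE; apply: differentiable_sum => i.
rewrite -fct_sumE; apply: differentiable_sum => j.
exact: differentiableZl.
Qed.

Lemma derive_mxE m k (A : V -> 'M[R]_(m, k)) x v i j :
  differentiable A x -> ('D_v A x) i j = 'D_v (fun y => A y i j) x.
Proof. by move=> dA; rewrite derive_mx ?mxE//; exact: diff_derivable. Qed.

Lemma differentiable_sum_seq (I : Type) (r : seq I) (P : pred I) (f : I -> V -> R) x :
  (forall i, differentiable (f i) x) ->
  differentiable (fun y => \sum_(i <- r | P i) f i y) x.
Proof.
move=> df; elim: r => [|i r ih].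
  by under eq_fun do rewrite big_nil; exact: differentiable_cst.
under eq_fun do rewrite big_cons; case: (P i) => //.
exact: differentiableD.
Qed.

Lemma differentiable_prod (I : Type) (r : seq I) (f : I -> V -> R) x :
  (forall i, differentiable (f i) x) ->
  differentiable (fun y => \prod_(i <- r) f i y) x.
Proof.
move=> df; elim: r => [|i r ih].
  by under eq_fun do rewrite big_nil; exact: differentiable_cst.
under eq_fun do rewrite big_cons.
exact: differentiableM.
Qed.

Lemma differentiable_det k (A : V -> 'M[R]_k) x :
  differentiable A x -> differentiable (fun y => \det (A y)) x.
Proof.
move=> /differentiable_mxP dA; apply: differentiable_sum_seq => s.
apply: differentiableM; first exact: differentiable_cst.
exact: differentiable_prod.
Qed.

Lemma differentiable_mulmx m k l (A : V -> 'M[R]_(m, k)) (B : V -> 'M[R]_(k, l)) x :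
  differentiable A x -> differentiable B x ->
  differentiable (fun y => A y *m B y) x.
Proof.
move=> /differentiable_mxP dA /differentiable_mxP dB.
apply/differentiable_mxP => i j; under eq_fun do rewrite mxE.
by apply: differentiable_sum_seq => a; exact: differentiableM.
Qed.

Lemma derive_mulmx m k l (A : V -> 'M[R]_(m, k)) (B : V -> 'M[R]_(k, l)) x v :
  differentiable A x -> differentiable B x ->
  'D_v (fun y => A y *m B y) x = 'D_v A x *m B x + A x *m 'D_v B x.
Proof.
move=> dA dB; have dAB := differentiable_mulmx dA dB.
apply/matrixP => i j; rewrite derive_mxE//; under eq_fun do rewrite mxE.
have dAe a : derivable (fun y => A y i a) x v.
  by apply: diff_derivable; apply: (differentiable_mxP _ _).2.
have dBe a : derivable (fun y => B y a j) x v.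
  by apply: diff_derivable; apply: (differentiable_mxP _ _).2.
rewrite -fct_sumE derive_sum => [|a]; last exact: derivableM.
rewrite !mxE -big_split/=; apply: eq_bigr => a _.
rewrite !derive_mxE// (deriveM (dAe a) (dBe a)).
by rewrite [RHS]addrC; congr (_ + _); exact: mulrC.
Qed.

Lemma differentiable_trmx m k (A : V -> 'M[R]_(m, k)) x :
  differentiable A x -> differentiable (fun y => (A y)^T) x.
Proof.
move=> /differentiable_mxP dA; apply/differentiable_mxP => i j.
by under eq_fun do rewrite mxE.
Qed.

Lemma derive_trmx m k (A : V -> 'M[R]_(m, k)) x v :
  differentiable A x -> 'D_v (fun y => (A y)^T) x = ('D_v A x)^T.
Proof.
move=> dA; apply/matrixP => i j; rewrite derive_mxE ?mxE ?derive_mxE//.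
  by under eq_fun do rewrite mxE.
exact: differentiable_trmx.
Qed.

(** The error terms of f and g at x agree near x, so both are little-o. *)
Lemma near_eq_differentiable (W : normedModType R) (f g : V -> W) x :
  {near x, f =1 g} -> differentiable f x -> differentiable g x.
Proof.
move=> fg df; have gx : g x = f x by rewrite (nbhs_singleton fg).
have dg : g \o shift x = cst (g x) + 'd f x +o_ 0 id.
  apply/eqaddoP => e e0.
  have /eqaddoP/(_ e e0) := diff_locally df.
  have fg0 : \forall h \near 0, f (h + x) = g (h + x).
    by have := fg; rewrite (near_shift 0) subr0.
  apply: filterS2 fg0 => h fgh.
  rewrite -[X in `|X| <= _]/(f (h + x) - (f x + 'd f x h)) => dfh.
  by rewrite -[X in `|X| <= _]/(g (h + x) - (g x + 'd f x h)) -fgh gx.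
have dfc : continuous ('d f x) by exact: diff_continuous.
have dgE := diff_unique dfc dg.
by apply/diff_locallyP; rewrite dgE; split.
Qed.

(** The determinant is continuous, so it stays nonzero. *)
Lemma unitmx_near k (A : V -> 'M[R]_k) x :
  differentiable A x -> A x \in unitmx -> \forall y \near x, A y \in unitmx.
Proof.
move=> dA Ax; have dx0 : \det (A x) != 0 by rewrite unitmxE unitfE in Ax.
have dc := differentiable_continuous (differentiable_det dA).
by apply: filterS (@cvgr_neq0 R R _ (nbhs x) _ _ _ dc dx0) => y;
  rewrite unitmxE unitfE.
Qed.

(** Cramer's rule: near x the inverse is the adjugate over the determinant,
    whose entries are rational in those of A. *)
Lemma differentiable_invmx k (A : V -> 'M[R]_k) x :
  differentiable A x -> A x \in unitmx ->
  differentiable (fun y => invmx (A y)) x.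
Proof.
move=> dA Ax.
have dd := differentiable_det dA.
have dx0 : \det (A x) != 0 by rewrite unitmxE unitfE in Ax.
apply: (@near_eq_differentiable _ (fun y => (\det (A y))^-1 *: \adj (A y))).
  by apply: filterS (unitmx_near dA Ax) => y; rewrite /invmx => ->.
apply/differentiable_mxP => i j; under eq_fun do rewrite !mxE.
apply: differentiableM; first exact: differentiableV.
apply: differentiableM; first exact: differentiable_cst.
apply: differentiable_det; apply/differentiable_mxP => a b.
by under eq_fun do rewrite !mxE; apply: (differentiable_mxP _ _).2.
Qed.

(** Obtained by differentiating the identity A^-1 A = 1. *)
Lemma derive_invmx k (A : V -> 'M[R]_k) x v :
  differentiable A x -> A x \in unitmx ->
  'D_v (fun y => invmx (A y)) x = - (invmx (A x) *m 'D_v A x *m invmx (A x)).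
Proof.
move=> dA Ax; have dV := differentiable_invmx dA Ax.
have Au : \forall y \near x, invmx (A y) *m A y = 1%:M.
  by apply: filterS (unitmx_near dA Ax) => y Ay; rewrite mulVmx.
have := near_eq_derive v Au; rewrite derive_mulmx// derive_cst.
move/(congr1 (mulmx^~ (invmx (A x)))); rewrite mul0mx mulmxDl mulmxK// => /eqP.
by rewrite addr_eq0 => /eqP.
Qed.

Lemma differentiable_row_mx k l (A : V -> 'M[R]_(1, k)) (B : V -> 'M[R]_(1, l)) x :
  differentiable A x -> differentiable B x ->
  differentiable (fun y => row_mx (A y) (B y)) x.
Proof.
move=> /differentiable_mxP dA /differentiable_mxP dB.
apply/differentiable_mxP => i j; case: (split_ordP j) => j' ->.
  by under eq_fun do rewrite row_mxEl.
by under eq_fun do rewrite row_mxEr.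
Qed.

Lemma derive_row_mx k l (A : V -> 'M[R]_(1, k)) (B : V -> 'M[R]_(1, l)) x v :
  differentiable A x -> differentiable B x ->
  'D_v (fun y => row_mx (A y) (B y)) x = row_mx ('D_v A x) ('D_v B x).
Proof.
move=> dA dB; have dAB := differentiable_row_mx dA dB.
apply/matrixP => i j; rewrite derive_mxE//; case: (split_ordP j) => j' ->.
  by rewrite row_mxEl derive_mxE//; under eq_fun do rewrite row_mxEl.
by rewrite row_mxEr derive_mxE//; under eq_fun do rewrite row_mxEr.
Qed.

Lemma differentiable_scalar_mx (f : V -> R) x :
  differentiable f x -> differentiable (fun y => (f y)%:M : 'M[R]_1) x.
Proof.
move=> df; apply/differentiable_mxP => i j.
by rewrite !ord1; under eq_fun do rewrite mxE eqxx mulr1n.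
Qed.

Lemma derive_scalar_mx (f : V -> R) x v :
  differentiable f x -> 'D_v (fun y => (f y)%:M : 'M[R]_1) x = ('D_v f x)%:M.
Proof.
move=> df; apply/matrixP => i j; rewrite derive_mxE.
  by rewrite !ord1 mxE eqxx mulr1n; under eq_fun do rewrite mxE eqxx mulr1n.
exact: differentiable_scalar_mx.
Qed.

Lemma derive_comp (U W : normedModType R) (f : U -> W) (phi : V -> U) x v :
  differentiable phi x -> differentiable f (phi x) ->
  'D_v (f \o phi) x = 'D_('D_v phi x) f (phi x).
Proof.
move=> dphi df; rewrite !deriveE//; last exact: differentiable_comp.
by rewrite diff_comp.
Qed.

Lemma derive_linear (W : normedModType R) (f : {linear V -> W}) x v :
  continuous f -> 'D_v f x = f v.
Proof.
by move=> fc; rewrite deriveE ?diff_lin//; exact: linear_differentiable.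
Qed.

Lemma differentiable_inv_sqrt (f : V -> R) x :
  differentiable f x -> 0 < f x -> differentiable (fun y => (Num.sqrt (f y))^-1) x.
Proof.
move=> df fx; apply: differentiableV; last by rewrite gt_eqF// sqrtr_gt0.
apply: (differentiable_comp df); apply/derivable1_diffP.
by have [] := is_derive1_sqrt fx.
Qed.

(** Obtained by differentiating s^2 f = 1, where s = 1 / sqrt f. *)
Lemma derive_inv_sqrt (f : V -> R) x v :
  differentiable f x -> 0 < f x ->
  'D_v (fun y => (Num.sqrt (f y))^-1) x
  = - ((Num.sqrt (f x))^-1 / (2 * f x)) * 'D_v f x.
Proof.
move=> df fx; set s := fun y => _.
have ds : differentiable s x := differentiable_inv_sqrt df fx.
have s0 : s x != 0 by rewrite invr_eq0 gt_eqF// sqrtr_gt0.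
have f0 : f x != 0 by rewrite gt_eqF.
have /(near_eq_derive v) : \forall y \near x, (s * s * f) y = 1.
  have fc := differentiable_continuous df.
  apply: filterS (@cvgr_gt _ _ (nbhs x) _ _ _ fc _ fx) => y fy.
  rewrite /s -[LHS]/(_ * _ * _) -invfM -expr2 sqr_sqrtr ?ltW// mulVf//.
  by rewrite gt_eqF.
have dsv := diff_derivable (v := v) ds; have dfv := diff_derivable (v := v) df.
rewrite derive_cst (deriveM (derivableM dsv dsv) dfv) (deriveM dsv dsv) => e.
rewrite -[(Num.sqrt _)^-1]/(s x).
have {}e : s x * (s x * 'D_v f x + 2 * f x * 'D_v s x) = 0.
  transitivity (s x * s x * 'D_v f x + f x * (s x * 'D_v s x + s x * 'D_v s x)).
    by ring.
  exact: e.
move/eqP: e; rewrite mulf_eq0 (negPf s0)/= addrC addr_eq0 => /eqP e.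
apply: (@mulfI _ (2 * f x)); first by rewrite mulf_neq0// pnatr_eq0.
by rewrite e; field.
Qed.

End MatrixCalculus.

Section PartialDerivatives.
Context {R : realType} {m k : nat} {W : normedModType R}.

Lemma derive_partial (f : 'rV[R]_k -> W) y w :
  differentiable f y -> 'D_w f y = \sum_b w 0 b *: partial b f y.
Proof.
move=> df; rewrite deriveE// [in LHS](row_sum_delta w) linear_sum.
by apply: eq_bigr => b _; rewrite linearZ /partial deriveE.
Qed.

Lemma partial_jacobian (f : 'rV[R]_m -> 'rV[R]_k) x i :
  differentiable f x -> partial i f x = row i ('J f x).
Proof. by move=> df; rewrite /partial deriveEjacobian// rowE. Qed.

End PartialDerivatives.

(** * Gradient and Hessian in a chart *)

Definition gradient {R : realType} {n : nat} (f : 'rV[R]_n -> R)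
    (y : 'rV[R]_n) : 'rV[R]_n :=
  \row_i partial i f y.

Section Gradient.
Context {R : realType} {n : nat}.
Variables (V : set 'rV[R]_n) (f : 'rV[R]_n -> R).
Hypotheses (f2 : Ck 2 V f).

Lemma Ck_differentiable (W : normedModType R) k (g : 'rV[R]_n -> W) y :
  Ck k.+1 V g -> V y -> differentiable g y.
Proof. by move=> [dg _] Vy; exact: dg. Qed.

Lemma Ck_partial (W : normedModType R) k (g : 'rV[R]_n -> W) i :
  Ck k.+1 V g -> Ck k V (partial i g).
Proof. by move=> [_ dg]; exact: dg. Qed.

Lemma differentiable_gradient y : V y -> differentiable (gradient f) y.
Proof.
move=> Vy; apply/differentiable_mxP => i j; under eq_fun do rewrite mxE.
exact: Ck_differentiable (Ck_partial j f2) Vy.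
Qed.

Lemma partial_gradient i y : V y ->
  partial i (gradient f) y = \row_j partial i (partial j f) y.
Proof.
move=> Vy; apply/rowP => j; rewrite /partial derive_mxE ?mxE.
  by under eq_fun do rewrite mxE.
exact: differentiable_gradient.
Qed.

End Gradient.

Section Levi_Civita.
Context {R : realType} {n : nat} (M : metricAtlas R n) (hM : semi_riemannian M).
Variables (d : cidx M) (y : 'rV[R]_n) (dy : Defs.codom d y).
Let g := metric d y.

Lemma nbhs_codom : \forall z \near y, Defs.codom d z.
Proof. by apply: open_nbhs_nbhs; split=> //; exact: (sr_codom_open hM). Qed.

Lemma differentiable_metric : differentiable (metric d) y.
Proof. exact: Ck_differentiable (sr_metric_smooth hM d 1) dy. Qed.

Lemma invmx_metric_sym : (invmx g)^T = invmx g.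
Proof. by rewrite trmx_inv (sr_metric_sym hM dy). Qed.

Lemma partial_metric_sym i : (partial i (metric d) y)^T = partial i (metric d) y.
Proof.
rewrite /partial -derive_trmx; last exact: differentiable_metric.
by apply: near_eq_derive; apply: filterS nbhs_codom => z /(sr_metric_sym hM).
Qed.

(** Christoffel symbols of the first kind. *)
Definition christoffel_lower i j : 'rV[R]_n :=
  \row_l (2^-1 * (partial i (metric d) y j l + partial j (metric d) y i l
     - partial l (metric d) y i j)).

Lemma christoffelE i j : christoffel d i j y = christoffel_lower i j *m invmx g.
Proof.
apply/rowP => k; rewrite !mxE mulr_sumr; apply: eq_bigr => l _.
by rewrite !mxE mulrCA mulrC -[in LHS]invmx_metric_sym mxE.
Qed.

(** Compatibility of the Levi-Civita connection with the metric. *)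
Lemma christoffel_lowerD i j k :
  christoffel_lower i j 0 k + christoffel_lower i k 0 j = partial i (metric d) y j k.
Proof.
rewrite !mxE.
have cancel (a a' b c : R) :
    a' = a -> 2^-1 * (a + b - c) + 2^-1 * (a' + c - b) = a.
  by move=> ->; field.
by apply: cancel; rewrite -[in LHS](partial_metric_sym i) mxE.
Qed.

End Levi_Civita.

Section Hessian.
Context {R : realType} {n : nat} (M : metricAtlas R n) (hM : semi_riemannian M).
Variables (u : M -> R) (hu : ck_function 2 u).
Variables (d : cidx M).

Definition hessian (y : 'rV[R]_n) : 'M[R]_n :=
  \matrix_(i, j) (partial i (partial j (u \o param d)) y
    - (christoffel d i j y *m (gradient (u \o param d) y)^T) 0 0).

Lemma hessianE y i j :
  (christoffel d i j y *m (gradient (u \o param d) y)^T) 0 0 =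
  partial i (partial j (u \o param d)) y - hessian y i j.
Proof. by rewrite [hessian y i j]mxE opprB addrC subrK. Qed.

(** The squared norm of grad u is du (grad u), because lowering the index of
    the gradient gives back du. *)
Lemma grad_sqnormE y : Defs.codom d y ->
  grad_sqnorm u d y = (grad u d y *m (gradient (u \o param d) y)^T) 0 0.
Proof.
move=> dy; rewrite /grad_sqnorm /ip /grad -/(gradient _ _) trmx_mul.
rewrite (invmx_metric_sym hM dy) mulmxA mulmxK//.
exact: (sr_metric_unit hM).
Qed.

Variables (y : 'rV[R]_n) (dy : Defs.codom d y).

Lemma differentiable_grad : differentiable (grad u d) y.
Proof.
apply: (@differentiable_mulmx _ _ _ _ _ (gradient (u \o param d))
  (fun z => invmx (metric d z))); first exact: differentiable_gradient (hu d) _ dy.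
by apply: differentiable_invmx; [exact: differentiable_metric|exact: sr_metric_unit].
Qed.

Lemma differentiable_grad_sqnorm : differentiable (grad_sqnorm u d) y.
Proof.
apply: (@near_eq_differentiable _ _ _
  (fun z => (grad u d z *m (gradient (u \o param d) z)^T) 0 0)).
  by apply: filterS (nbhs_codom hM dy) => z dz; rewrite grad_sqnormE.
apply: (differentiable_mxP _ _).2; apply: differentiable_mulmx.
  exact: differentiable_grad.
exact/differentiable_trmx/(differentiable_gradient (hu d)).
Qed.

(** The covariant derivative of grad u is the Hessian with one index raised.
    Differentiating grad u = du g^-1 produces the term -grad u (d_i g) g^-1,
    which metric compatibility combines with the Christoffel term. *)
Lemma covariant_grad i :
  partial i (grad u d) y + \sum_j grad u d y 0 j *: christoffel d i j y
  = row i (hessian y) *m invmx (metric d y).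
Proof.
have gu := sr_metric_unit hM dy; have dg := differentiable_metric hM dy.
have dD := differentiable_gradient (hu d) dy.
rewrite {1}/partial derive_mulmx//; last exact: differentiable_invmx.
rewrite derive_invmx// mulmxN mulmxA [in X in - X]mulmxA -mulmxBl.
rewrite -[X in X *m 'D__ _ _]/(grad u d y).
under eq_bigr do rewrite (christoffelE hM dy) scalemxAl.
rewrite -mulmx_suml -mulmxDl; congr (_ *m _).
rewrite -/(gradient _) -!/(partial i _ _) (partial_gradient (hu d))//.
have hE k : hessian y i k = partial i (partial k (u \o param d)) y
    - (christoffel_lower d y i k *m (grad u d y)^T) 0 0.
  by rewrite mxE (christoffelE hM dy) trmx_mul (invmx_metric_sym hM dy) mulmxA.
apply/rowP => k; rewrite [RHS]mxE {}hE; move: (grad u d y) => G.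
rewrite !mxE summxE -addrA; congr (_ + _); rewrite addrC.
apply/eqP; rewrite -subr_eq0 opprK addrAC subr_eq0; apply/eqP.
rewrite -big_split/=; apply: eq_bigr => j _.
rewrite -(christoffel_lowerD hM dy i j k) !mxE; ring.
Qed.

(** d |grad u|^2 = 2 Hess u (grad u, .): one Hessian comes from the covariant
    derivative of grad u, the other from the derivative of du; the Christoffel
    terms cancel. *)
Lemma partial_grad_sqnorm i :
  partial i (grad_sqnorm u d) y = 2 * (row i (hessian y) *m (grad u d y)^T) 0 0.
Proof.
have dG := differentiable_grad.
have dD := differentiable_gradient (hu d) dy.
have dDT := differentiable_trmx dD.
have -> : partial i (grad_sqnorm u d) y =
    'D_(delta_mx 0 i) (fun z => (grad u d z *m (gradient (u \o param d) z)^T) 0 0) y.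
  by apply: near_eq_derive; apply: filterS (nbhs_codom hM dy) => z; exact: grad_sqnormE.
rewrite -derive_mxE; last exact: differentiable_mulmx.
rewrite derive_mulmx// derive_trmx// -!/(partial i _ _) (partial_gradient (hu d))//.
have /(canRL (addrK _)) -> := covariant_grad i.
rewrite mulmxBl mulmx_suml -mulmxA.
rewrite -[in X in X *m (gradient _ _)^T](invmx_metric_sym hM dy) -trmx_mul.
under eq_bigr do rewrite -scalemxAl.
rewrite -/(grad u d y); move: (grad u d y) (hessian y) (hessianE y i) => G H hE.
rewrite !mxE summxE mulr_sumr -sumrB -big_split/=; apply: eq_bigr => k _.
have -> (A : 'M[R]_1) : (G 0 k *: A) 0 0 = G 0 k * A 0 0 by rewrite mxE.
rewrite hE !mxE; ring.
Qed.

(** Leibniz rule for the divergence, the divergence of grad u being the trace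
    of the Hessian. *)
Lemma divergence_scale_grad (s : cidx M -> 'rV[R]_n -> R) :
  differentiable (s d) y ->
  divergence (fun c x => s c x *: grad u c x) d y =
  \sum_i partial i (s d) y * grad u d y 0 i
  + s d y * \tr (hessian y *m invmx (metric d y)).
Proof.
move=> ds; have dG := differentiable_grad.
rewrite /divergence /mxtrace mulr_sumr -big_split/=; apply: eq_bigr => i _.
have -> : (hessian y *m invmx (metric d y)) i i =
  (row i (hessian y) *m invmx (metric d y)) 0 i by rewrite -row_mul [RHS]mxE.
rewrite -covariant_grad.
have dsG : differentiable (fun x => s d x *: grad u d x) y.
  apply/differentiable_mxP => a b; under eq_fun do rewrite mxE.
  by apply: differentiableM => //; apply: (differentiable_mxP _ _).2.
have DE (A B : 'rV[R]_n) : (A + B) 0 i = A 0 i + B 0 i by rewrite mxE.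
rewrite !DE {1}/partial derive_mxE// mulrDr addrA; congr (_ + _); last first.
  under eq_bigr do rewrite mxE -scalerA.
  by rewrite -scaler_sumr mxE.
under eq_fun do rewrite mxE.
rewrite deriveM; [|exact: diff_derivable|]; last first.
  by apply: diff_derivable; apply: (differentiable_mxP _ _).2.
by rewrite -derive_mxE// addrC; congr (_ + _); exact: mulrC.
Qed.

Variable eps : R.
Let q := eps + grad_sqnorm u d y.

(** The trace of Hess u with respect to the induced metric g + eps du^2 of the
    graph, the inverse of that metric being expanded by Sherman-Morrison. *)
Definition graph_trace_hessian (z : 'rV[R]_n) : R :=
  \tr (hessian z *m invmx (metric d z)) -
  (eps + grad_sqnorm u d z)^-1 * (grad u d z *m hessian z *m (grad u d z)^T) 0 0.

(** The scalar factor s = 1 / sqrt (e q) satisfies ds = - s dq / (2 q), and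
    dq is twice Hess u (grad u, .), which yields the second term of the trace. *)
Lemma divergence_unit_grad (e : R) : 0 < e * q ->
  divergence
    (fun c x => (Num.sqrt (e * (eps + grad_sqnorm u c x)))^-1 *: grad u c x) d y
  = (Num.sqrt (e * q))^-1 * graph_trace_hessian y.
Proof.
move=> eq0; have /andP[e0 q0] : (e != 0) && (q != 0).
  by rewrite -negb_or -mulf_eq0 gt_eqF.
have dq : differentiable (fun x => eps + grad_sqnorm u d x) y.
  apply: (@differentiableD _ _ _ (cst eps)); first exact: differentiable_cst.
  exact: differentiable_grad_sqnorm.
have deq : differentiable (fun x => e * (eps + grad_sqnorm u d x)) y.
  by apply: (@differentiableM _ _ (cst e)); first exact: differentiable_cst.
rewrite (divergence_scale_grad
  (s := fun c x => (Num.sqrt (e * (eps + grad_sqnorm u c x)))^-1)); last first.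
  exact: differentiable_inv_sqrt.
have dsi i : partial i (fun x => (Num.sqrt (e * (eps + grad_sqnorm u d x)))^-1) y
    = - ((Num.sqrt (e * q))^-1 / q) * (row i (hessian y) *m (grad u d y)^T) 0 0.
  rewrite /partial derive_inv_sqrt//.
  rewrite (@deriveMl _ _ (fun x => eps + grad_sqnorm u d x)); last first.
    exact: diff_derivable.
  rewrite (@deriveD _ _ _ (cst eps) (grad_sqnorm u d)); last 2 first.
  - exact: derivable_cst.
  - exact/diff_derivable/differentiable_grad_sqnorm.
  rewrite derive_cst add0r -/(partial i _ y) partial_grad_sqnorm -/q.
  by field; rewrite q0 e0 gt_eqF// sqrtr_gt0.
rewrite /graph_trace_hessian -/q mulrBr addrC; congr (_ + _).
rewrite -(mulmxA (grad u d y)) mulrA -mulNr [X in _ = _ * X]mxE mulr_sumr.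
apply: eq_bigr => i _; rewrite dsi -mulrA; congr (_ * _).
by rewrite -row_mul [X in X * _]mxE mulrC.
Qed.

End Hessian.

(** * Linear algebra of hypersurfaces *)

Section LinearAlgebra.
Context {F : fieldType}.

(** Uniqueness of the splitting into normal and tangential parts: when the
    induced form is nondegenerate, the orthogonal complement of the row space
    of J meets that row space trivially. *)
Lemma proj_kermx m k (J : 'M[F]_(m, k)) (G : 'M[F]_k) (v w : 'rV[F]_k) :
  J *m G *m J^T \in unitmx -> w *m (G *m J^T) = 0 -> (v - w <= J)%MS ->
  v *m proj_mx (kermx (G *m J^T)) <<J>>%MS = w.
Proof.
move=> JGu w0 vw.
have dx : (kermx (G *m J^T) :&: <<J>>)%MS = 0.
  apply/eqP; rewrite -submx0; apply/rV_subP => z; rewrite sub_capmx.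
  move=> /andP[/sub_kermxP zk]; rewrite genmxE => /submxP[a za].
  have aG0 : a *m (J *m G *m J^T) = 0 by rewrite !mulmxA -za -mulmxA.
  by rewrite za -[a](mulmxK JGu) aG0 !mul0mx sub0mx.
rewrite -[v](subrK w) mulmxDl (proj_mx_0 dx) ?genmxE// add0r (proj_mx_id dx)//.
by apply/sub_kermxP.
Qed.

Lemma invmx_unique k (A B : 'M[F]_k) : A *m B = 1%:M -> invmx A = B.
Proof.
by move=> AB; have [Au _] := mulmx1_unit AB; rewrite -[RHS](mulKmx Au) AB mulmx1.
Qed.

(** For a^2 = 1 the usual denominator 1 + a b A^-1 b^T is a times the one
    below. *)
Lemma sherman_morrison k (A : 'M[F]_k) (a : F) (b : 'rV[F]_k) :
  A \in unitmx -> a * a = 1 -> a + (b *m invmx A *m b^T) 0 0 != 0 ->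
  (A + a *: (b^T *m b)) *m (invmx A
    - (a + (b *m invmx A *m b^T) 0 0)^-1 *: (invmx A *m b^T *m b *m invmx A)) = 1%:M.
Proof.
move=> Au a2; set t := (_ *m _) 0 0 => q0.
have bAb : b *m invmx A *m b^T = t%:M by rewrite [LHS]mx11_scalar.
rewrite mulmxDl !mulmxBr mulmxV// -!scalemxAr !mulmxA mulmxV// mul1mx.
rewrite -!scalemxAl -!mulmxA (mulmxA (invmx A)) (mulmxA b) (mulmxA b (invmx A)) bAb.
rewrite mul_scalar_mx -scalemxAr mulmxA !scalerA.
set X := b^T *m _; rewrite -addrA -!scaleNr -!scalerDl.
rewrite (_ : - _ + _ = 0) ?scale0r ?addr0//.
transitivity ((a + t)^-1 * (a * a - 1)); first by field.
by rewrite a2 subrr mulr0.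
Qed.

Lemma mxtrace_mul_tr k (A B : 'M[F]_k) : \sum_i \sum_j A i j * B i j = \tr (A *m B^T).
Proof.
by apply: eq_bigr => i _; rewrite !mxE; apply: eq_bigr => j _; rewrite mxE.
Qed.

(** A trace with respect to a bilinear form is invariant under change of
    basis. *)
Lemma mxtrace_congr k (P A H : 'M[F]_k) : P \in unitmx -> A \in unitmx ->
  \sum_i \sum_j invmx (P *m A *m P^T) i j * (P *m H *m P^T) i j = \tr (invmx A *m H^T).
Proof.
move=> Pu Au; rewrite mxtrace_mul_tr.
have -> : invmx (P *m A *m P^T) = invmx P^T *m invmx A *m invmx P.
  apply: invmx_unique; rewrite !mulmxA mulmxK ?unitmx_tr//.
  by rewrite mulmxK// mulmxV.
rewrite !trmx_mul trmxK !mulmxA mulmxKV//.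
rewrite -!mulmxA mxtrace_mulC -!mulmxA mulmxV ?unitmx_tr//.
by rewrite mulmx1.
Qed.

End LinearAlgebra.

(** * The Levi-Civita connection of the product with a line *)

(** The coordinate formula as a function of the inverse metric B and of the
    array dG of partial derivatives of the metric, so that it can be evaluated
    on block matrices by pure algebra. *)
Definition christoffel_symbol {R : realType} {m : nat} (B : 'M[R]_m)
    (dG : 'I_m -> 'M[R]_m) (i j : 'I_m) : 'rV[R]_m :=
  \row_k (2^-1 * \sum_l B k l * (dG i j l + dG j i l - dG l i j)).

(** The inverse metric is block diagonal with blocks B and C; only the first
    block of the metric varies, and only along the first n coordinates. *)
Section ChristoffelBlock.
Context {R : realType} {n m : nat} (B : 'M[R]_n) (C : 'M[R]_m).
Variables (dg : 'I_n -> 'M[R]_n) (dG : 'I_(n + m) -> 'M[R]_(n + m)).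
Hypotheses (dGl : forall i, dG (lshift m i) = block_mx (dg i) 0 0 0)
           (dGr : forall i, dG (rshift n i) = 0).
Let Gamma := christoffel_symbol (block_mx B 0 0 C) dG.

Let dG_col a b k : dG a b (rshift n k) = 0.
Proof.
case: (split_ordP a) => a' ->; last by rewrite dGr mxE.
by rewrite dGl; case: (split_ordP b) => b' ->; rewrite ?block_mxEur ?block_mxEdr mxE.
Qed.

Let dG_row a b k : dG a (rshift n b) k = 0.
Proof.
case: (split_ordP a) => a' ->; last by rewrite dGr mxE.
by rewrite dGl; case: (split_ordP k) => k' ->; rewrite ?block_mxEdl ?block_mxEdr mxE.
Qed.

Let dG_vert b k l : dG (rshift n b) k l = 0.
Proof. by rewrite dGr mxE. Qed.

Let Gamma_horizontal i j :
  Gamma (lshift m i) (lshift m j) = row_mx (christoffel_symbol B dg i j) 0.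
Proof.
apply/rowP => k; rewrite mxE big_split_ord/=.
rewrite [X in _ + X]big1 ?addr0 => [|l _]; last first.
  by rewrite !dG_col dG_vert addr0 subr0 mulr0.
under eq_bigr do rewrite !dGl !block_mxEul.
case: (split_ordP k) => k' ->.
  by rewrite row_mxEl [RHS]mxE; under eq_bigr do rewrite block_mxEul.
by rewrite row_mxEr mxE big1 ?mulr0// => l _; rewrite block_mxEdl mxE mul0r.
Qed.

Let Gamma_vertical_r a j : Gamma a (rshift n j) = 0.
Proof.
apply/rowP => k; rewrite mxE [RHS]mxE big1 ?mulr0// => l _.
by rewrite dG_row dG_col dG_vert subr0 addr0 mulr0.
Qed.

Let Gamma_vertical_l i b : Gamma (rshift n i) b = 0.
Proof.
apply/rowP => k; rewrite mxE [RHS]mxE big1 ?mulr0// => l _.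
by rewrite !dG_row dG_vert subr0 addr0 mulr0.
Qed.

Lemma christoffel_symbol_block (v w : 'rV[R]_n) (s t : 'rV[R]_m) :
  \sum_a \sum_b (row_mx v s 0 a * row_mx w t 0 b)
      *: christoffel_symbol (block_mx B 0 0 C) dG a b =
  row_mx (\sum_i \sum_j (v 0 i * w 0 j) *: christoffel_symbol B dg i j) 0.
Proof.
rewrite -/Gamma big_split_ord/= [X in _ + X]big1 ?addr0 => [|i _]; last first.
  by rewrite big1// => b _; rewrite Gamma_vertical_l scaler0.
under eq_bigr => i _.
  rewrite big_split_ord/= [X in _ + X]big1 ?addr0 => [|b _]; last first.
    by rewrite Gamma_vertical_r scaler0.
  under eq_bigr do rewrite !row_mxEl Gamma_horizontal scale_row_mx scaler0.
  over.
have rowE (I : finType) (A : I -> 'rV[R]_n) :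
    \sum_i row_mx (A i) (0 : 'rV[R]_m) = row_mx (\sum_i A i) 0.
  elim/big_ind2: _ => [|A1 A2 B1 B2 -> ->|//]; first by rewrite row_mx0.
  by rewrite add_row_mx addr0.
by rewrite -rowE; apply: eq_bigr => i _; rewrite -rowE.
Qed.

End ChristoffelBlock.

Section ProductConnection.
Context {R : realType} {n : nat} (M : metricAtlas R n) (hM : semi_riemannian M).
Variables (eps : R) (eps0 : eps != 0).
Variables (d : cidx M) (y : 'rV[R]_(n + 1)) (dy : Defs.codom d (lsubmx y)).

Let dprod : cidx (prod_line M eps) := d.

Lemma partial_prod_metric a :
  partial a (metric dprod) y =
  block_mx ('D_(lsubmx (delta_mx 0 a)) (metric d) (lsubmx y)) 0 0 0.
Proof.
have dg := differentiable_metric hM dy.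
have dl : differentiable (lsubmx : 'rV[R]_(n + 1) -> _) y := differentiable_lsubmx y.
have dgl : differentiable (metric d \o lsubmx) y by exact: differentiable_comp.
have dge i j : differentiable (fun z : 'rV[R]_(n + 1) => metric d (lsubmx z) i j) y.
  exact: (differentiable_mxP _ _).2.
have dG : differentiable (metric dprod) y.
  apply/differentiable_mxP => i j.
  case: (split_ordP i) => i' ->; case: (split_ordP j) => j' ->.
  - by under eq_fun do rewrite block_mxEul.
  - by under eq_fun do rewrite block_mxEur mxE.
  - by under eq_fun do rewrite block_mxEdl mxE.
  - by under eq_fun do rewrite block_mxEdr mxE.
apply/matrixP => i j; rewrite /partial derive_mxE//.
case: (split_ordP i) => i' ->; case: (split_ordP j) => j' ->.
- rewrite block_mxEul; under eq_fun do rewrite block_mxEul.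
  transitivity (('D_(delta_mx 0 a) (metric d \o lsubmx) y) i' j').
    exact/esym/(derive_mxE (A := metric d \o lsubmx)).
  rewrite (derive_comp _ dl dg).
  rewrite (derive_linear (f := lsubmx))//.
  by move=> z; apply: differentiable_continuous; exact: differentiable_lsubmx.
- rewrite block_mxEur mxE; under eq_fun do rewrite block_mxEur mxE.
  by rewrite derive_cst.
- rewrite block_mxEdl mxE; under eq_fun do rewrite block_mxEdl mxE.
  by rewrite derive_cst.
- rewrite block_mxEdr mxE; under eq_fun do rewrite block_mxEdr mxE.
  by rewrite derive_cst.
Qed.

(** The connection of a product with a line is the connection of the first
    factor, because the product metric has no mixed terms and is constant along
    the line. *)
Lemma christoffel_prod (v w : 'rV[R]_n) (s t : 'rV[R]_1) :
  \sum_a \sum_b (row_mx v s 0 a * row_mx w t 0 b) *: christoffel dprod a b y =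
  row_mx (\sum_i \sum_j (v 0 i * w 0 j) *: christoffel d i j (lsubmx y)) 0.
Proof.
have gu := sr_metric_unit hM dy.
have eu : (eps%:M : 'M[R]_1) \in unitmx by rewrite unitmxE det_scalar expr1 unitfE.
have Gamma a b : christoffel dprod a b y = christoffel_symbol
    (block_mx (invmx (metric d (lsubmx y))) 0 0 (invmx eps%:M))
    (fun a => partial a (metric dprod) y) a b.
  by rewrite -invmx_block_diag// block_diag_mx_unit gu.
under eq_bigr do under eq_bigr do rewrite Gamma.
apply: (@christoffel_symbol_block _ _ _ _ _
  (fun i => partial i (metric d) (lsubmx y))) => i.
  rewrite partial_prod_metric (_ : lsubmx (delta_mx 0 _) = delta_mx 0 i)//.
  by apply/rowP => l; rewrite !mxE !eqxx (inj_eq (@lshift_inj _ _)).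
rewrite partial_prod_metric (_ : lsubmx (delta_mx 0 _) = 0) ?derive0 ?block_mx0//.
by apply/rowP => j; rewrite !mxE eq_lrshift andbF.
Qed.

End ProductConnection.

(** * The graph in a pair of charts *)

Section GraphInCharts.
Context {R : realType} {n : nat} (M : metricAtlas R n) (hM : semi_riemannian M).
Variables (u : M -> R) (hu : ck_function 2 u).
Variables (eps : R) (epsK : eps * eps = 1).
Variables (c d : cidx M) (x : 'rV[R]_n) (cdx : overlap c d x).

Let dprod : cidx (prod_line M eps) := d.
Let phi : 'rV[R]_n -> 'rV[R]_n := transition c d.
Let y := phi x.
Let f := u \o param d.
Let h := u \o param c.
Let P := 'J phi x.
Let D := gradient f y.
Let g := metric d y.
Let F := graph_map eps u.
Let L := local_rep F c dprod.
Let q := eps + grad_sqnorm u d y.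

Lemma overlap_codom (z : 'rV[R]_n) : overlap c d z ->
  Defs.codom c z /\ Defs.codom d (phi z) /\ f (phi z) = h z.
Proof.
move=> [p [cp dp] <-]; split; first by exists p.
rewrite /f /h /phi /transition /= (sr_paramK hM cp) (sr_paramK hM dp).
by split=> //; exists p.
Qed.

Lemma nbhs_overlap (z : 'rV[R]_n) : overlap c d z -> \forall z' \near z, overlap c d z'.
Proof.
move=> [p [cp dp] pz]; have cz : Defs.codom c z by exists p.
have : \forall z' \near z, dom d (param c z').
  apply: (sr_param_continuous hM cz); apply: open_nbhs_nbhs.
  by split; [exact: (sr_dom_open hM)|rewrite -pz (sr_paramK hM cp)].
apply: filterS2 (nbhs_codom hM cz) => _ [p' cp' <-].
by rewrite (sr_paramK hM cp') => dp'; exists p'.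
Qed.

Let phi2 : Ck 2 (overlap c d) phi := sr_transition_smooth hM c d 2.

Lemma transition_codom : Defs.codom d y.
Proof. by have [_ []] := overlap_codom cdx. Qed.

Lemma differentiable_transition z : overlap c d z -> differentiable phi z.
Proof. exact: Ck_differentiable phi2. Qed.

Lemma differentiable_height z : overlap c d z -> differentiable h z.
Proof. by move=> /overlap_codom[cz _]; exact: Ck_differentiable (hu c) cz. Qed.

(** The metrics of the two charts are congruent through P and both are
    nondegenerate. *)
Lemma transition_unit : P \in unitmx.
Proof.
have [cx _] := overlap_codom cdx.
have := sr_metric_unit hM cx; rewrite (sr_metric_tensor hM cdx).
by rewrite !unitmx_mul => /andP[/andP[]].
Qed.

(** Near a point of the overlap h is f \o phi; this is the chain rule for it,
    and the next lemma is the second-order one. *)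
Lemma partial_height i z : overlap c d z ->
  partial i h z = (partial i phi z *m (gradient f (phi z))^T) 0 0.
Proof.
move=> oz; have [_ [dphiz _]] := overlap_codom oz.
have -> : partial i h z = 'D_(delta_mx 0 i) (f \o phi) z.
  by apply: near_eq_derive; apply: filterS (nbhs_overlap oz) => z' /overlap_codom[_ []].
have df : differentiable f (phi z) by exact: Ck_differentiable (hu d) dphiz.
rewrite (derive_comp _ (differentiable_transition oz) df) derive_partial// [RHS]mxE.
by apply: eq_bigr => b _; rewrite !mxE.
Qed.

Lemma partial2_height i j :
  partial i (partial j h) x = (partial i (partial j phi) x *m D^T) 0 0
    + \sum_a \sum_b P i a * P j b * partial a (partial b f) y.
Proof.
have dphi : differentiable phi x by exact: differentiable_transition.
have dphij : differentiable (partial j phi) x.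
  exact: Ck_differentiable (Ck_partial j phi2) cdx.
have dD : differentiable (gradient f) y by
  exact: differentiable_gradient (hu d) _ transition_codom.
have dDphi : differentiable (gradient f \o phi) x by exact: differentiable_comp.
have dDT := differentiable_trmx dDphi.
have -> : partial i (partial j h) x =
    'D_(delta_mx 0 i) (fun z => (partial j phi z *m ((gradient f \o phi) z)^T) 0 0) x.
  by apply: near_eq_derive; apply: filterS (nbhs_overlap cdx) => z /partial_height.
rewrite -derive_mxE; last exact: differentiable_mulmx.
rewrite derive_mulmx// derive_trmx// derive_comp// (derive_partial _ dD).
rewrite -!/(partial i _ _) !(partial_jacobian _ dphi) -/P -/y -/D.
have mxD (A B : 'M[R]_1) : (A + B) 0 0 = A 0 0 + B 0 0 by rewrite mxE.
rewrite mxD; congr (_ + _).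
rewrite [LHS]mxE [RHS]exchange_big/=; apply: eq_bigr => b _.
rewrite mxE [X in _ * X]mxE summxE mulr_sumr; apply: eq_bigr => a _.
by rewrite (partial_gradient (hu d) _ transition_codom) !mxE; ring.
Qed.

Lemma local_repE : L = fun z => row_mx (phi z) (h z)%:M.
Proof. by []. Qed.

Lemma partial_local_rep i z : overlap c d z ->
  partial i L z = row_mx (partial i phi z) (partial i h z)%:M.
Proof.
move=> oz; have dh := differentiable_height oz.
rewrite /partial local_repE derive_row_mx.
- by rewrite derive_scalar_mx.
- exact: differentiable_transition.
- exact: differentiable_scalar_mx.
Qed.

Lemma jacobian_local_rep : 'J L x = row_mx P (P *m D^T).
Proof.
have dL : differentiable L x.
  rewrite local_repE; apply: differentiable_row_mx.
    exact: differentiable_transition.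
  exact/differentiable_scalar_mx/differentiable_height.
apply/row_matrixP => i; rewrite -partial_jacobian// partial_local_rep//.
rewrite row_row_mx row_mul -partial_jacobian; last exact: differentiable_transition.
congr row_mx; rewrite partial_height//; exact/esym/mx11_scalar.
Qed.

(** The differential of the defining function t - u of the graph. *)
Definition graph_conormal : 'cV[R]_(n + 1) := col_mx (- D^T) 1%:M.
Definition graph_normal : 'rV[R]_(n + 1) := row_mx (- eps *: grad u d y) 1%:M.

Lemma ambient_normal :
  graph_normal *m ambient_metric F c dprod x = eps *: graph_conormal^T.
Proof.
rewrite /ambient_metric -/L local_repE /= row_mxKl.
rewrite mul_row_block !mulmx0 addr0 add0r -scalemxAl mulmxKV; last first.
  exact: (sr_metric_unit hM transition_codom).
rewrite tr_col_mx trmx1 linearN/= trmxK scale_row_mx scalerN -scaleNr.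
by rewrite mul1mx scalemx1.
Qed.

Lemma jacobian_conormal : 'J L x *m graph_conormal = 0.
Proof. by rewrite jacobian_local_rep mul_row_col mulmx1 mulmxN addNr. Qed.

Lemma normal_conormal : (graph_normal *m graph_conormal) 0 0 = eps * q.
Proof.
rewrite mul_row_col mulmx1 mulmxN -scalemxAl scaleNr opprK !mxE eqxx mulrDr epsK addrC.
by rewrite -/y (grad_sqnormE hM u transition_codom) mxE.
Qed.

(** A vector killed by the conormal has its vertical component determined by
    the horizontal one, and P is onto. *)
Lemma conormal_tangent (z : 'rV[R]_(n + 1)) :
  z *m graph_conormal = 0 -> (z <= 'J L x)%MS.
Proof.
rewrite -[z]hsubmxK mul_row_col mulmx1 mulmxN => /eqP.
rewrite addrC subr_eq0 => /eqP ->.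
apply/submxP; exists (lsubmx z *m invmx P).
by rewrite jacobian_local_rep mul_mx_row mulmxA mulmxKV// transition_unit.
Qed.

Hypothesis gamma_unit : induced_metric F c dprod x \in unitmx.
Hypothesis q0 : q != 0.

(** The multiple of the normal vector is found by pairing with the conormal,
    which sees the normal with value eps q; as eps^2 = 1, the
    coefficient 1 / (eps q) is eps / q. *)
Lemma normal_partE v :
  normal_part F c dprod x v = (eps / q * (v *m graph_conormal) 0 0) *: graph_normal.
Proof.
apply: proj_kermx => //.
- rewrite -scalemxAl mulmxA ambient_normal -scalemxAl -trmx_mul.
  by rewrite jacobian_conormal trmx0 !scaler0.
- apply: conormal_tangent; rewrite mulmxBl -scalemxAl.
  rewrite [v *m _]mx11_scalar [graph_normal *m _]mx11_scalar normal_conormal.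
  rewrite scale_scalar_mx -raddfB/= (_ : _ - _ = 0) ?raddf0//.
  rewrite [(_%:M) _ _]mxE eqxx mulr1n mulrAC mulrA -(mulrA (eps / q)).
  rewrite -{1}[(v *m _) 0 0]mul1r -mulrBl.
  by rewrite mulrACA mulVf// epsK mulr1 subrr mul0r.
Qed.

Lemma partial2_local_rep i j :
  partial i (partial j L) x =
  row_mx (partial i (partial j phi) x) (partial i (partial j h) x)%:M.
Proof.
have [cx _] := overlap_codom cdx.
have dphij : differentiable (partial j phi) x.
  exact: Ck_differentiable (Ck_partial j phi2) cdx.
have dhj : differentiable (partial j h) x.
  exact: Ck_differentiable (Ck_partial j (hu c)) cx.
have -> : partial i (partial j L) x =
    'D_(delta_mx 0 i) (fun z => row_mx (partial j phi z) (partial j h z)%:M) x.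
  by apply: near_eq_derive; apply: filterS (nbhs_overlap cdx) => z /partial_local_rep.
rewrite derive_row_mx ?derive_scalar_mx//; exact: differentiable_scalar_mx.
Qed.

(** Pairing with the conormal cancels the second derivatives of phi, so what
    is left of the covariant second derivative of F is tensorial: the Hessian
    of u pulled back by P. *)
Lemma cov_dF_conormal i j :
  (cov_dF F c dprod i j x *m graph_conormal) 0 0 = (P *m hessian u d y *m P^T) i j.
Proof.
have eps0 : eps != 0 by apply: contra_eq_neq epsK => ->; rewrite mul0r eq_sym oner_eq0.
have Lx : lsubmx (L x) = y by rewrite local_repE row_mxKl.
have dLx : Defs.codom d (lsubmx (L x)) by rewrite Lx; exact: transition_codom.
rewrite /cov_dF -/L partial2_local_rep !(partial_local_rep _ cdx).
rewrite (christoffel_prod hM eps0 dLx) Lx add_row_mx addr0 mul_row_col mulmx1.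
have mxD (A B : 'M[R]_1) : (A + B) 0 0 = A 0 0 + B 0 0 by rewrite mxE.
have mxN (A : 'M[R]_1) : (- A) 0 0 = - A 0 0 by rewrite mxE.
rewrite mxD mulmxN mulmxDl mxN mxD [X in _ + X = _]mxE eqxx mulr1n partial2_height.
(* The terms containing the second derivatives of phi cancel. *)
rewrite opprD addrACA addNr add0r addrC.
rewrite mulmx_suml summxE -sumrB [RHS]mxE.
under [RHS]eq_bigr do rewrite mxE mulr_suml.
rewrite [RHS]exchange_big/=; apply: eq_bigr => a _.
rewrite mulmx_suml summxE -sumrB; apply: eq_bigr => b _.
have dphi : differentiable phi x by exact: differentiable_transition.
rewrite -scalemxAl [X in _ - X]mxE hessianE !(partial_jacobian _ dphi) -/P.
move: (hessian u d y) P => H Q; rewrite !mxE; ring.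
Qed.

Lemma induced_metricE :
  induced_metric F c dprod x = P *m (g + eps *: (D^T *m D)) *m P^T.
Proof.
rewrite /induced_metric jacobian_local_rep /ambient_metric -/L local_repE/= row_mxKl.
rewrite tr_row_mx mul_row_block !mulmx0 addr0 add0r mul_row_col.
rewrite mulmxDr mulmxDl; congr (_ + _).
by rewrite mul_mx_scalar trmx_mul trmxK -scalemxAr -!scalemxAl !mulmxA.
Qed.

Lemma trace_second_form :
  \sum_i \sum_j invmx (induced_metric F c dprod x) i j
    * (cov_dF F c dprod i j x *m graph_conormal) 0 0 = graph_trace_hessian u d eps y.
Proof.
have gu : g \in unitmx := sr_metric_unit hM transition_codom.
have DG : D *m invmx g = grad u d y by [].
have GD : invmx g *m D^T = (grad u d y)^T.
  by rewrite -DG trmx_mul (invmx_metric_sym hM transition_codom).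
have qE : q = eps + (D *m invmx g *m D^T) 0 0.
  by rewrite DG /q (grad_sqnormE hM u transition_codom).
have sm : (g + eps *: (D^T *m D)) *m
    (invmx g - q^-1 *: ((grad u d y)^T *m grad u d y)) = 1%:M.
  by rewrite -GD -DG mulmxA qE; apply: sherman_morrison; rewrite -?qE.
have [ku _] := mulmx1_unit sm.
under eq_bigr do under eq_bigr do rewrite cov_dF_conormal.
rewrite induced_metricE mxtrace_congr ?transition_unit// (invmx_unique sm).
rewrite -mxtrace_tr trmx_mul trmxK linearB/= linearZ/= trmx_mul trmxK.
rewrite (invmx_metric_sym hM transition_codom) mulmxBr raddfB/= -scalemxAr.
rewrite mxtraceZ; congr (_ - _ * _).
by rewrite mulmxA mxtrace_mulC mulmxA [LHS]trace_mx11.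
Qed.

(** Both sides are multiples of the normal vector; comparing the coefficients,
    eps / q times the trace and eps / q, gives the scalar equation. *)
Lemma soliton_chartP :
  mean_curvature F c dprod x = normal_part F c dprod x (@d_t R n) <->
  graph_trace_hessian u d eps y = 1.
Proof.
have eps0 : eps != 0 by apply: contra_eq_neq epsK => ->; rewrite mul0r eq_sym oner_eq0.
have dtC : (@d_t R n *m graph_conormal) 0 0 = 1.
  by rewrite mul_row_col mul0mx add0r mulmx1 mxE.
have N0 : graph_normal != 0.
  apply/eqP => /(congr1 rsubmx) /matrixP/(_ 0 0); rewrite row_mxKr !mxE => /eqP.
  by rewrite oner_eq0.
rewrite normal_partE dtC mulr1.
have -> : mean_curvature F c dprod x =
    (eps / q * graph_trace_hessian u d eps y) *: graph_normal.
  rewrite -trace_second_form /mean_curvature mulr_sumr scaler_suml.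
  apply: eq_bigr => i _.
  rewrite mulr_sumr scaler_suml; apply: eq_bigr => j _.
  by rewrite /second_form normal_partE scalerA mulrCA.
split=> [/eqP|->]; last by rewrite mulr1.
rewrite -subr_eq0 -scalerBl scaler_eq0 (negPf N0) orbF -{2}[eps / q]mulr1 -mulrBr.
by rewrite mulf_eq0 mulf_eq0 invr_eq0 (negPf eps0) (negPf q0)/= subr_eq0 => /eqP.
Qed.

End GraphInCharts.

(** * Causal character of the graph and the equivalence *)

Lemma ip_prod_line (R : realType) (n : nat) (M : metricAtlas R n) (eps : R)
    (c : cidx M) (x v w : 'rV[R]_n) (t r s : 'rV[R]_1) :
  ip (M := prod_line M eps) c (row_mx x t) (row_mx v r) (row_mx w s)
  = ip c x v w + eps * (r 0 0 * s 0 0).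
Proof.
rewrite /ip /= row_mxKl mul_row_block !mulmx0 addr0 add0r tr_row_mx mul_row_col mxE.
congr (_ + _); rewrite mul_mx_scalar -scalemxAl mxE; congr (_ * _).
by rewrite mxE big_ord1 mxE.
Qed.

(** Before normalization the normal vector has squared norm q, so
    eps' = q / W^2; a vanishing W would make its inverse, hence eps', zero. *)
Lemma graph_causal_sign (R : realType) (n : nat) (M : metricAtlas R n) (u : M -> R)
    (eps eps' : R) (c : cidx M) (p : M) :
  eps * eps = 1 -> eps' != 0 ->
  ip (M := prod_line M eps) c (chart (m := prod_line M eps) c (graph_map eps u p))
     (upward_normal eps u c (chart c p)) (upward_normal eps u c (chart c p)) = eps' ->
  0 < eps' * (eps + grad_sqnorm u c (chart c p)).
Proof.
move=> epsK eps'0; rewrite /upward_normal /d_t add_row_mx addr0 add0r !scale_row_mx.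
rewrite ip_prod_line; set q := eps + _; set W := graph_W _ _ _ _.
have -> : ip c (chart c p) (W^-1 *: (- eps *: grad u c (chart c p)))
      (W^-1 *: (- eps *: grad u c (chart c p)))
    = W^-1 * W^-1 * grad_sqnorm u c (chart c p).
  rewrite /ip !scalerA linearZ/= -!scalemxAl -scalemxAr scalerA mxE; congr (_ * _).
  by rewrite mulrACA mulrNN epsK mulr1.
rewrite !mxE eqxx mulr1 [eps * _]mulrC -mulrDr (addrC _ eps) -/q => e.
have W0 : W^-1 != 0 by apply: contra_neq eps'0 => W0; rewrite -e W0 !mul0r.
have W2 : 0 < W^-1 * W^-1 by rewrite -expr2 lt0r sqrf_eq0 W0 sqr_ge0.
have q0 : q != 0 by apply: contra_neq eps'0 => q0; rewrite -e q0 mulr0.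
by rewrite -e -mulrA -expr2 pmulr_rgt0// lt0r sqrf_eq0 q0 sqr_ge0.
Qed.

Theorem proposition1 (R : realType) (n : nat) (M : metricAtlas R n)
    (u : M -> R) (eps eps' : R)
    (hM : semi_riemannian M)
    (hu : ck_function 2 u)
    (heps : eps = 1 \/ eps = -1)
    (heps' : eps' = 1 \/ eps' = -1)
    (hF : nondegenerate_map (graph_map eps u))
    (hnu : forall (c : cidx M) (p : M), dom c p ->
       ip (M := prod_line M eps) c
          (chart (m := prod_line M eps) c (graph_map eps u p))
          (upward_normal eps u c (chart c p))
          (upward_normal eps u c (chart c p)) = eps') :
  translating_soliton (graph_map eps u) <->
  (forall (c : cidx M) (p : M), dom c p ->
     divergence
       (fun d x =>
          (Num.sqrt (eps' * (eps + grad_sqnorm u d x)))^-1 *: grad u d x)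
       c (chart c p)
     = (Num.sqrt (eps' * (eps + grad_sqnorm u c (chart c p))))^-1).
Proof.
have epsK : eps * eps = 1 by case: heps => ->; rewrite ?mulr1 ?mulrNN ?mulr1.
have eps'0 : eps' != 0 by case: heps' => ->; rewrite ?oppr_eq0 oner_eq0.
have sign (c : cidx M) p (cp : dom c p) :
  0 < eps' * (eps + grad_sqnorm u c (chart c p)).
  exact: (graph_causal_sign epsK eps'0 (hnu c p cp)).
have pdeP (c : cidx M) p : dom c p ->
    divergence (fun d x =>
       (Num.sqrt (eps' * (eps + grad_sqnorm u d x)))^-1 *: grad u d x) c (chart c p)
      = (Num.sqrt (eps' * (eps + grad_sqnorm u c (chart c p))))^-1 <->
    graph_trace_hessian u c eps (chart c p) = 1.
  move=> cp; have cc : Defs.codom c (chart c p) by exists p.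
  have s0 : (Num.sqrt (eps' * (eps + grad_sqnorm u c (chart c p))))^-1 != 0.
    by rewrite invr_eq0 gt_eqF// sqrtr_gt0 sign.
  rewrite (divergence_unit_grad hM hu cc (sign _ _ cp)).
  split=> [e|->]; last by rewrite mulr1.
  by apply: (mulfI s0); rewrite e mulr1.
have solP (c d : cidx M) p : dom c p -> dom d p ->
    mean_curvature (graph_map eps u) c (d : cidx (prod_line M eps)) (chart c p)
      = normal_part (graph_map eps u) c (d : cidx (prod_line M eps)) (chart c p)
          (@d_t R n)
    <-> graph_trace_hessian u d eps (chart d p) = 1.
  move=> cp dp; have cd : overlap c d (chart c p) by exists p.
  have yE : transition c d (chart c p) = chart d p.
    by rewrite /transition/= (sr_paramK hM cp).
  have q0 : eps + grad_sqnorm u d (transition c d (chart c p)) != 0.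
    by rewrite yE; have := sign _ _ dp; apply: contraTneq => ->; rewrite mulr0 ltxx.
  have gu : induced_metric (graph_map eps u) c (d : cidx (prod_line M eps)) (chart c p)
      \in unitmx by exact: hF.
  by rewrite (soliton_chartP hM hu epsK cd gu q0) yE.
(* The PDE in chart c is the soliton equation in the pair (c, c); conversely
   the soliton equation in the pair (c, d) is the PDE in the target chart d. *)
split=> [sol c p cp|pde c d p cp [dp _]].
  by apply/pdeP => //; apply/(solP c c p cp cp)/sol.
by apply/solP => //; apply/pdeP => //; exact: pde.
Qed.
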